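(* Let $n\in\mathbb{N}$ and let $\Delta: M_n\to M_n$ be a weak-2-local $^*$-derivation (not assumed to be linear nor continuous). Then $\Delta$ is linear and a derivation.
   Context: $M_n$ denotes the C$^*$-algebra of all $n\times n$ complex matrices. A derivation on a C$^*$-algebra $A$ is a (complex) linear map $D:A\to A$ with $D(ab)=D(a)b+aD(b)$ for all $a,b\in A$; it is a $^*$-derivation if moreover $D(a^* )=D(a)^*$ for all $a\in A$. $A^*$ denotes the space of bounded linear functionals on $A$. A (not necessarily linear) mapping $\Delta:A\to A$ is a weak-2-local $^*$-derivation if for every $a,b\in A$ and every $\phi\in A^*$ there exists a $^*$-derivation $D_{a,b,\phi}:A\to A$, depending on $a$, $b$ and $\phi$, such that $\phi(\Delta(a))=\phi(D_{a,b,\phi}(a))$ and $\phi(\Delta(b))=\phi(D_{a,b,\phi}(b))$. *)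

(* Defs.v *)
From mathcomp Require Import all_boot all_order all_algebra.
From mathcomp Require Import complex.
From mathcomp Require Import boolp classical_sets reals.

Set Implicit Arguments.
Unset Strict Implicit.
Unset Printing Implicit Defensive.

Import Order.TTheory GRing.Theory Num.Theory.
Local Open Scope ring_scope.
Local Open Scope sesquilinear_scope.
Local Open Scope classical_set_scope.

Section Definitions.
Variables (R : realType) (n : nat).
Local Notation C := R[i].
Local Notation Mn := 'M[C]_n.

Definition l2norm (x : 'cV[C]_n) : R :=
  Num.sqrt (\sum_i Normc.normc (x i 0) ^+ 2).

(* The C*-norm of M_n: a acts on the Hilbert space C^n. *)
Definition opnorm (a : Mn) : R :=
  sup [set l2norm (a *m x) | x in [set x | l2norm x <= 1]].

Definition bounded_functional (phi : Mn -> C) : Prop :=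
  scalar phi /\
  exists K : R, forall a : Mn, Normc.normc (phi a) <= K * opnorm a.

Definition derivation (D : Mn -> Mn) : Prop :=
  linear D /\ forall a b : Mn, D (a *m b) = D a *m b + a *m D b.

Definition star_derivation (D : Mn -> Mn) : Prop :=
  derivation D /\ forall a : Mn, D (a ^t*) = (D a) ^t*.

Definition weak_2_local_star_derivation (Delta : Mn -> Mn) : Prop :=
  forall (a b : Mn) (phi : Mn -> C), bounded_functional phi ->
    exists D : Mn -> Mn,
      [/\ star_derivation D,
          phi (Delta a) = phi (D a) &
          phi (Delta b) = phi (D b)].

End Definitions.

(* Main.v *)
Require Import Defs.
From HB Require Import structures.
From mathcomp Require Import all_boot all_order all_algebra.
From mathcomp Require Import complex.
From mathcomp Require Import boolp classical_sets reals.

(** Every functional on M_n is m |-> tr(hm), so the hypothesis says that each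
    pair of numbers tr(h Delta(a)), tr(h Delta(b)) can be computed with a
    genuine star-derivation D in place of Delta. The difficulty is additivity,
    since a + b, a and b are three points and D only controls two.

    Linearity rests on the identity tr(a Delta(a)) = 0, valid for every complex
    matrix a because tr(a D(a)) = tr(D(a^2))/2 and derivations have trace zero
    ([trace_self]). Testing against hermitian h, for which tr(h D(x)) is real
    when x is hermitian, one finds Delta(x + iy) = Delta(x) + i Delta(y) for
    hermitian x, y ([weak_hermitian]). Substituting x + iy for a, the imaginary
    cross terms give tr(y Delta(x)) = - tr(x Delta(y)) ([trace_antisym]). The
    right-hand side is additive in x, hence so is Delta on hermitian matrices,
    and homogeneity, which involves only the two points ka and a, then gives
    linearity on M_n.

    A linear Delta is a derivation because Delta(1) = 0 and a Delta(b) c = 0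
    whenever ab = 0 = bc, two properties that it inherits from derivations one
    functional at a time. They suffice because M_n is spanned by idempotents
    ([local_derivation_is_derivation]). *)

Set Implicit Arguments.
Unset Strict Implicit.
Unset Printing Implicit Defensive.

Import Order.TTheory GRing.Theory Num.Theory.
Local Open Scope ring_scope.

Local Notation idempotent e := (e *m e = e).
Local Notation hermitian h := ((map_mx Num.conj (trmx h)) = h).

(** * Linear maps on matrices that are locally derivations *)

(** M_n is spanned by its idempotents: the E_ii, and the E_ii + E_ij for
    i <> j. *)
Lemma idempotent_span_ind (F : fieldType) (n : nat) (P : 'M[F]_n -> Prop) :
    (forall c x y, P x -> P y -> P (c *: x + y)) ->
    (forall e, idempotent e -> P e) ->
  forall x, P x.
Proof.
move=> Plin Pidem x.
have P0 : P 0 by apply: Pidem; rewrite mul0mx.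
have Pdelta i j : P (delta_mx i j).
  have Pii : P (delta_mx i i) by apply: Pidem; rewrite mul_delta_mx.
  have [<-//|neq_ij] := eqVneq i j.
  have -> : delta_mx i j =
      -1 *: delta_mx i i + (delta_mx i i + delta_mx i j) :> 'M[F]_n.
    by rewrite scaleN1r addKr.
  apply: Plin => //; apply: Pidem.
  rewrite mulmxDl !mulmxDr !mul_delta_mx.
  by rewrite !(mul_delta_mx_0 _ _ _ (_ : j != i)) 1?eq_sym // !addr0.
rewrite [x]matrix_sum_delta.
have PD y z : P y -> P z -> P (y + z) by rewrite -{2}[y]scale1r; apply: Plin.
apply: (big_ind P) => // i _; apply: (big_ind P) => // j _.
by rewrite -[X in P X]addr0; apply: Plin.
Qed.

(** Makes the theory of bundled linear maps available for a map that is only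
    known to satisfy the linearity equation. *)
Lemma linear_bundle (F : fieldType) (n : nat) (D : 'M[F]_n -> 'M[F]_n) :
  linear D -> exists D' : {linear 'M[F]_n -> 'M[F]_n}, D' = D :> (_ -> _).
Proof.
move=> linD.
pose D' : {linear 'M[F]_n -> 'M[F]_n} :=
  HB.pack D (GRing.isLinear.Build _ _ _ _ D linD).
by exists D'.
Qed.

(** For idempotents e and g, applying the hypothesis to the triples
    (1 - e, eg, 1 - g) and (e, (1 - e)g, 1 - g) gives
    D(eg)(1 - g) = e D(g)(1 - g). By linearity e may be any matrix a;
    subtracting the same identity for the idempotent 1 - g, for which
    D(1 - g) = - D(g), gives the Leibniz rule for a and g, and hence for a and
    any b. *)
Lemma local_derivation_is_derivation (F : fieldType) (n : nat)
    (D : {linear 'M[F]_n -> 'M[F]_n}) :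
    D 1%:M = 0 ->
    (forall a b c : 'M[F]_n, a *m b = 0 -> b *m c = 0 -> a *m D b *m c = 0) ->
  forall a b : 'M[F]_n, D (a *m b) = D a *m b + a *m D b.
Proof.
move=> D1 Dloc a b.
have compl (g : 'M[F]_n) : idempotent g ->
    g *m (1%:M - g) = 0 /\ (1%:M - g) *m g = 0.
  by move=> gg; rewrite mulmxBl mulmxBr mul1mx mulmx1 gg subrr.
have compl_idem (g : 'M[F]_n) : idempotent g -> idempotent (1%:M - g).
  by move=> /compl[g0 _]; rewrite {1}mulmxBl mul1mx g0 subr0.
have key g x : idempotent g ->
    D (x *m g) *m (1%:M - g) = x *m D g *m (1%:M - g).
  move=> gg; elim/idempotent_span_ind: x => [c x y Hx Hy|e ee].
    by rewrite !mulmxDl -!scalemxAl linearP /= mulmxDl -scalemxAl Hx Hy.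
  have [g0 _] := compl g gg; have [e0 e1] := compl e ee.
  have H1 : (1%:M - e) *m D (e *m g) *m (1%:M - g) = 0.
    by apply: Dloc; rewrite ?mulmxA ?e1 ?mul0mx // -mulmxA g0 mulmx0.
  have H2 : e *m D ((1%:M - e) *m g) *m (1%:M - g) = 0.
    by apply: Dloc; rewrite ?mulmxA ?e0 ?mul0mx // -mulmxA g0 mulmx0.
  move: H1; rewrite mulmxBl mul1mx mulmxBl => /eqP; rewrite subr_eq0 => /eqP ->.
  move: H2; rewrite mulmxBl mul1mx (linearB D) (mulmxBr e) mulmxBl => /eqP.
  by rewrite subr_eq0 => /eqP ->.
elim/idempotent_span_ind: b => [c x y Hx Hy|g gg].
  rewrite mulmxDr -scalemxAr !(linearP D) /= Hx Hy !mulmxDr -!scalemxAr.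
  by rewrite scalerDr addrACA.
have := key g a gg.
have := key _ a (compl_idem g gg); rewrite subKr (linearB D) D1 sub0r.
rewrite mulmxBr mulmx1 (linearB D) /= mulmxBl mulmxN mulNmx => H1.
rewrite !mulmxBr !mulmx1 => H2.
apply/(addIr (- (D (a *m g) *m g))); rewrite H2.
by rewrite addrAC H1 addrC.
Qed.

(** * Trace functionals are bounded *)

Section Norms.
Variables (R : realType) (n : nat).
Local Notation C := R[i].
Implicit Types (a : 'M[C]_n) (x : 'cV[C]_n).

Lemma normc_ge0 (z : C) : 0 <= Normc.normc z.
Proof. by case: z => ? ?; apply: sqrtr_ge0. Qed.

Lemma normc_sum (I : Type) (r : seq I) (f : I -> C) :
  Normc.normc (\sum_(i <- r) f i) <= \sum_(i <- r) Normc.normc (f i).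
Proof.
elim/big_rec2: _ => [|i y z _ le_yz]; first by rewrite Normc.normc0.
by apply: le_trans (le_normcD _ _) _; rewrite lerD2l.
Qed.

Lemma normc_le_l2norm x i : Normc.normc (x i 0) <= l2norm x.
Proof.
rewrite -[leLHS]ger0_norm ?normc_ge0// -sqrtr_sqr ler_wsqrtr//.
rewrite (bigD1 i)//= lerDl sumr_ge0// => j _; exact: exprn_ge0 (normc_ge0 _).
Qed.

(** The entry a_ij is a coordinate of the image of the j-th unit vector. For the
    supremum to dominate that image, the set of norms must be bounded above;
    the bound used sums the moduli of the entries of each row, as the
    coordinates of a vector in the unit ball have modulus at most 1. *)
Lemma normc_le_opnorm a i j : Normc.normc (a i j) <= opnorm a.
Proof.
have -> : a i j = (a *m delta_mx j 0 : 'cV_n) i 0 by rewrite -colE mxE.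
apply: le_trans (normc_le_l2norm _ _) _.
apply: ub_le_sup; last first.
  exists (delta_mx j 0) => //=.
  rewrite /l2norm (bigD1 j)//= big1 => [|k nkj].
    by rewrite mxE !eqxx Normc.normc1 expr1n addr0 sqrtr1.
  by rewrite mxE (negPf nkj) Normc.normc0 expr0n.
exists (Num.sqrt (\sum_k (\sum_l Normc.normc (a k l)) ^+ 2)) => _ [x /= x1 <-].
rewrite ler_wsqrtr// ler_sum// => k _.
rewrite ler_sqr ?nnegrE ?normc_ge0 ?sumr_ge0// => [|l _]; last exact: normc_ge0.
rewrite mxE; apply: le_trans (normc_sum _ _) _.
apply: ler_sum => l _; rewrite Normc.normcM ler_piMr ?normc_ge0//.
exact: le_trans (normc_le_l2norm _ _) x1.
Qed.

Lemma trace_bounded_functional (h : 'M[C]_n) :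
  bounded_functional (fun m => \tr (h *m m)).
Proof.
split=> [c u v|]; first by rewrite mulmxDr -scalemxAr mxtraceD mxtraceZ.
exists (\sum_i \sum_j Normc.normc (h i j)) => a.
apply: le_trans (normc_sum _ _) _; rewrite mulr_suml; apply: ler_sum => i _.
rewrite mxE; apply: le_trans (normc_sum _ _) _.
rewrite mulr_suml; apply: ler_sum => j _.
by rewrite Normc.normcM ler_wpM2l ?normc_ge0 ?normc_le_opnorm.
Qed.

End Norms.

(** * Derivations and the trace *)

Lemma derivation1 (R : realType) (n : nat) (D : 'M[R[i]]_n -> 'M[R[i]]_n) :
  derivation D -> D 1%:M = 0.
Proof.
move=> [_ DM]; have := DM 1%:M 1%:M.
by rewrite !mulmx1 mul1mx -[LHS]addr0 => /addrI.
Qed.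

(** It is enough to treat an idempotent e. Then D(e) = D(e)e + e D(e), so
    e D(e) e is twice itself and vanishes, and both summands have trace
    tr(e D(e)) = tr(e D(e) e). *)
Lemma trace_derivation (R : realType) (n : nat)
    (D : 'M[R[i]]_n -> 'M[R[i]]_n) :
  derivation D -> forall x, \tr (D x) = 0.
Proof.
move=> [linD DM]; elim/idempotent_span_ind => [c x y Hx Hy|e ee].
  by rewrite linD mxtraceD mxtraceZ Hx Hy mulr0 addr0.
have De : D e = D e *m e + e *m D e by rewrite -{1}ee DM.
have eDe : e *m D e *m e = 0.
  have := congr1 (fun m => e *m m *m e) De.
  rewrite mulmxDr mulmxDl !mulmxA ee -!mulmxA ee -[LHS]addr0 => /addrI <-//.
have tr0 : \tr (e *m D e) = 0.
  by rewrite -{1}ee -mulmxA mxtrace_mulC eDe mxtrace0.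
by rewrite De mxtraceD (mxtrace_mulC (D e)) tr0 addr0.
Qed.

Lemma trace_self_derivation (R : realType) (n : nat)
    (D : 'M[R[i]]_n -> 'M[R[i]]_n) :
  derivation D -> forall a, \tr (a *m D a) = 0.
Proof.
move=> derD a; have := trace_derivation derD (a *m a).
rewrite (proj2 derD) mxtraceD (mxtrace_mulC (D a)) -mulr2n => /eqP.
by rewrite mulrn_eq0 => /eqP.
Qed.

(** * Hermitian matrices *)

Section Hermitian.
Variables (C : numClosedFieldType) (n : nat).
Implicit Types (a b h m : 'M[C]_n).
Local Notation "a ^*m" := (map_mx Num.conj (trmx a)) (at level 2).

Lemma hermitian_decomposition a :
  exists x y, [/\ hermitian x, hermitian y & a = x + 'i *: y].
Proof.
exists (2^-1 *: (a + a^*m)), ((2 * 'i)^-1 *: (a - a^*m)).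
have conj2 : (2^-1 : C)^* = 2^-1 by rewrite fmorphV /= conjC_nat.
have conj2i : ((2 * 'i)^-1 : C)^* = - (2 * 'i)^-1.
  by rewrite fmorphV rmorphM /= conjC_nat conjCi mulrN invrN.
split.
- by apply/matrixP=> i j; rewrite !mxE rmorphM rmorphD /= conj2 conjCK addrC.
- apply/matrixP=> i j; rewrite !mxE rmorphM rmorphB /= conj2i conjCK.
  by rewrite mulNr -mulrN opprB.
- rewrite scalerA invfM mulrC mulfVK ?neq0Ci// -scalerDr.
  rewrite addrACA subrr addr0 -mulr2n -scaler_nat scalerA mulVf ?scale1r//.
  by rewrite pnatr_eq0.
Qed.

(** Hermitian matrices span M_n over the complex numbers, so they separate
    matrices under the trace pairing. Testing against them only is what lets
    real and imaginary parts of traces be compared. *)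
Lemma trace_hermitian_inj m m' :
  (forall h, hermitian h -> \tr (h *m m) = \tr (h *m m')) -> m = m'.
Proof.
move=> eq_tr.
have {}eq_tr a : \tr (a *m m) = \tr (a *m m').
  have [x [y [hx hy ->]]] := hermitian_decomposition a.
  by rewrite !mulmxDl !mxtraceD -!scalemxAl !mxtraceZ !eq_tr.
have entry (k : 'M[C]_n) i j : \tr (delta_mx j i *m k) = k i j.
  rewrite /mxtrace (bigD1 j)//= big1 ?addr0 => [|l /negPf nlj].
    rewrite mxE (bigD1 i)//= big1 ?addr0 => [|l /negPf nli].
      by rewrite mxE !eqxx mul1r.
    by rewrite mxE nli andbF mul0r.
  by rewrite mxE big1 // => r _; rewrite mxE nlj mul0r.
by apply/matrixP=> i j; rewrite -!entry.
Qed.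

Lemma trace_hermitian_real h k :
  hermitian h -> hermitian k -> \tr (h *m k) \is Num.real.
Proof.
move=> hh hk; rewrite CrealE; apply/eqP.
have <- : \tr ((h *m k)^*m) = (\tr (h *m k))^*.
  by rewrite rmorph_sum; apply: eq_bigr => i _; rewrite !mxE.
by rewrite trmx_mul map_mxM hh hk mxtrace_mulC.
Qed.

End Hermitian.

(** * Weak-2-local star-derivations *)

Section WeakTwoLocal.
Variables (R : realType) (n : nat) (Delta : 'M[R[i]]_n -> 'M[R[i]]_n).
Hypothesis hDelta : weak_2_local_star_derivation Delta.
Implicit Types (a b c h x y : 'M[R[i]]_n).

Lemma trace_local h a b : exists D, [/\ star_derivation D,
  \tr (h *m Delta a) = \tr (h *m D a) & \tr (h *m Delta b) = \tr (h *m D b)].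
Proof. exact: hDelta (trace_bounded_functional h). Qed.

Lemma trace_self a : \tr (a *m Delta a) = 0.
Proof.
have [D [[derD _] -> _]] := trace_local a a a.
exact: trace_self_derivation.
Qed.

Lemma weak_map1 : Delta 1%:M = 0.
Proof.
apply: trace_hermitian_inj => h _.
have [D [[derD _] -> _]] := trace_local h 1%:M 1%:M.
by rewrite (derivation1 derD).
Qed.

(** A derivation D has a D(b) c = (D(ab) - D(a) b) c = 0. For a given h, the
    functional tr(h (a m c)) of m is tr(cham), so Delta(b) is tested with the
    matrix cha. *)
Lemma weak_separated a b c : a *m b = 0 -> b *m c = 0 -> a *m Delta b *m c = 0.
Proof.
move=> ab0 bc0; apply: trace_hermitian_inj => h _.
rewrite mulmx0 mxtrace0 !mulmxA mxtrace_mulC !mulmxA.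
have [D [[[linD DM] _] -> _]] := trace_local (c *m h *m a) b b.
have aDb : a *m D b = - (D a *m b).
  apply/eqP; rewrite -addr_eq0 addrC -DM ab0.
  by have [D' <-] := linear_bundle linD; rewrite linear0.
rewrite -mulmxA aDb mulmxN raddfN /= mulmxA mxtrace_mulC !mulmxA bc0.
by rewrite !mul0mx mxtrace0 oppr0.
Qed.

Lemma weak_homogeneous (k : R[i]) a : Delta (k *: a) = k *: Delta a.
Proof.
apply: trace_hermitian_inj => h _.
have [D [[[linD _] _] -> eqa]] := trace_local h (k *: a) a.
rewrite -scalemxAr mxtraceZ eqa.
by have [D' <-] := linear_bundle linD; rewrite linearZ -scalemxAr mxtraceZ.
Qed.

(** For hermitian h, tr(h D(x + iy)) has real part tr(h D(x)) and imaginary part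
    tr(h D(y)). One derivation identifies the real part of tr(h Delta(x + iy))
    with tr(h Delta(x)); another, agreeing with Delta at x + iy and y,
    identifies its imaginary part with tr(h Delta(y)). *)
Lemma weak_hermitian x y : hermitian x -> hermitian y ->
  Delta (x + 'i *: y) = Delta x + 'i *: Delta y.
Proof.
move=> hx hy; apply: trace_hermitian_inj => h hh.
have real_tr D z : star_derivation D -> hermitian z ->
    \tr (h *m D z) \is Num.real.
  by move=> [_ Dstar] hz; apply: trace_hermitian_real => //; rewrite -Dstar hz.
have split_tr D : star_derivation D ->
    \tr (h *m D (x + 'i *: y)) = \tr (h *m D x) + 'i * \tr (h *m D y).
  move=> [[linD _] _]; have [D' <-] := linear_bundle linD.
  by rewrite linearD linearZ mulmxDr mxtraceD -scalemxAr mxtraceZ.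
have [D [sD eqD eqx]] := trace_local h (x + 'i *: y) x.
have [E [sE eqE eqy]] := trace_local h (x + 'i *: y) y.
rewrite mulmxDr mxtraceD -scalemxAr mxtraceZ eqx eqy eqD split_tr //.
congr (_ + 'i * _).
have := congr1 (fun z => 'Im z) (etrans (esym eqD) eqE).
by rewrite /= !split_tr // !Im_rect ?real_tr.
Qed.

(** The polarization of tr(a Delta(a)) = 0 that is available before
    additivity is known: with a = x + iy, the diagonal terms vanish and only i
    times the sum of the cross terms is left. *)
Lemma trace_antisym x y : hermitian x -> hermitian y ->
  \tr (y *m Delta x) = - \tr (x *m Delta y).
Proof.
move=> hx hy; apply/eqP; rewrite -addr_eq0 addrC.
have := trace_self (x + 'i *: y); rewrite weak_hermitian //.
rewrite mulmxDl !mulmxDr -!scalemxAr -!scalemxAl !mxtraceD !mxtraceZ.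
rewrite !trace_self mulr0 mulr0 addr0 add0r -mulrDr => /eqP.
by rewrite mulf_eq0 (negPf (neq0Ci _)).
Qed.

(** By antisymmetry the argument x + y can be moved out of Delta, into the
    linear slot of the trace pairing. *)
Lemma weak_additive_hermitian x y : hermitian x -> hermitian y ->
  Delta (x + y) = Delta x + Delta y.
Proof.
move=> hx hy; apply: trace_hermitian_inj => h hh.
have hxy : hermitian (x + y) by rewrite linearD map_mxD hx hy.
rewrite mulmxDr mxtraceD (trace_antisym hxy hh) (trace_antisym hx hh).
rewrite (trace_antisym hy hh).
by rewrite mulmxDl mxtraceD opprD.
Qed.

Lemma weak_linear : linear Delta.
Proof.
move=> k a b; rewrite -weak_homogeneous; move: (k *: a) => {k}a.
have [x [y [hx hy ->]]] := hermitian_decomposition a.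
have [z [t [hz ht ->]]] := hermitian_decomposition b.
rewrite addrACA -scalerDr !weak_hermitian ?weak_additive_hermitian //.
- by rewrite scalerDr addrACA.
- by rewrite linearD map_mxD hx hz.
- by rewrite linearD map_mxD hy ht.
Qed.

End WeakTwoLocal.

Theorem theorem3p11 (R : realType) (n : nat)
    (Delta : 'M[R[i]]_n -> 'M[R[i]]_n)
    (hDelta : weak_2_local_star_derivation Delta) :
  linear Delta /\ derivation Delta.
Proof.
have linDelta := weak_linear hDelta.
split=> //; split=> //.
have Delta1 := weak_map1 hDelta.
have := weak_separated hDelta; move: Delta1.
have [D <-] := linear_bundle linDelta.
exact: local_derivation_is_derivation.
Qed.
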